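(* There exists a deterministic weak-probe local computation algorithm for weak $2$-coloring that, on every $n$-vertex input graph, answers a query to a vertex $v$ using at most $\log^* n + 2d_v + O(1)$ weak probes, where $d_v$ is the degree of $v$.
   Context: The input is a simple undirected graph $G=(V,E)$ with $n$ vertices with distinct IDs, represented as an array: cell $(v,0)$ holds the degree $d_v$ of $v$ and cell $(v,j)$, $1\le j\le d_v$, holds the ID of the neighbor at $v$'s $j$-th port. A weak probe specifies a cell $(v,j)$ and returns its content. A deterministic local computation algorithm receives a query vertex, makes probes, and returns that vertex's color; the answers to all queries must be consistent with a single valid solution. A weak $2$-coloring is a map $col:V\to\{0,1\}$ such that every non-isolated vertex has a neighbor of a different color.
   Formalization: The vertex IDs are assumed to be natural numbers at most n^c for an arbitrary fixed c, and the algorithm and the O(1) constant may depend on c; with an unbounded range of IDs no log* n bound is possible (already on cycles, by Ramsey's theorem). *)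

(* Defs.v *)
From mathcomp Require Import all_boot.

Set Implicit Arguments.
Unset Strict Implicit.
Unset Printing Implicit Defensive.

(* Least k such that the k-fold iterated base-2 logarithm of n is at most 1.
   Rounding each logarithm up ([up_log]) does not change this value: the
   thresholds 1, 2, 4, 16, ... are integers, so log_2 m <= t iff
   ceil(log_2 m) <= t.  The search range is large enough because
   ceil(log_2 m) < m for m > 1 (see [logstarP]). *)
Definition logstar (n : nat) : nat :=
  find (fun k => iter k (up_log 2) n <= 1) (iota 0 n.+1).

Lemma up_log2_lt (m : nat) : 1 < m -> up_log 2 m < m.
Proof.
case: m => [//|[//|m]] _; rewrite ltnS; apply: up_log_min => //.
exact: ltn_expl.
Qed.

Lemma logstarP (n : nat) :
  iter (logstar n) (up_log 2) n <= 1 /\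
  forall k, k < logstar n -> 1 < iter k (up_log 2) n.
Proof.
pose p k := iter k (up_log 2) n <= 1.
have bnd k : iter k (up_log 2) n <= maxn 1 (n - k).
  elim: k => [|k IH]; first by rewrite subn0 leq_maxr.
  rewrite iterS; have [le1|gt1] := leqP (iter k (up_log 2) n) 1.
    by move: le1; case: (iter _ _ _) => [|[|//]] _; rewrite leq_max ?up_log1.
  have lt := leq_trans (up_log2_lt gt1) IH.
  move: (leq_trans gt1 IH); rewrite leq_max ltnn /= => gt1'.
  move: lt; rewrite (maxn_idPr (ltnW gt1')) => lt.
  rewrite leq_max subnS; apply/orP; right.
  by rewrite -ltnS prednK // ltnW.
have hasp : has p (iota 0 n.+1).
  apply/hasP; exists n; first by rewrite mem_iota add0n leqnn.
  by have := bnd n; rewrite subnn.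
have lts : logstar n < n.+1 by rewrite /logstar -[X in _ < X](size_iota 0) -has_find.
split; first by have := nth_find 0 hasp; rewrite nth_iota // add0n.
move=> k ltk; have := before_find 0 ltk.
by rewrite nth_iota ?add0n ?(ltn_trans ltk) // => /negbT; rewrite -ltnNge.
Qed.

(* A simple undirected graph on [T], with a port numbering (an ordering of the
   neighbors of each vertex) and distinct IDs.  Algorithms only see the IDs. *)
Record input_graph (T : finType) := InputGraph {
  adj : rel T;
  adj_sym : symmetric adj;
  adj_irr : irreflexive adj;
  ports : T -> seq T;
  ports_uniq : forall v, uniq (ports v);
  mem_ports : forall v u, (u \in ports v) = adj v u;
  vid : T -> nat;
  vid_inj : injective vid
}.

Definition degree (T : finType) (G : input_graph T) (v : T) : nat :=
  #|[set u | adj G v u]|.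

(* [None] is the reply to a probe of a cell that does not exist: [x] is not the
   ID of a vertex, or [j] exceeds its degree.  Ports are numbered from 1. *)
Definition cell (T : finType) (G : input_graph T) (x j : nat) : option nat :=
  if [pick v | vid G v == x] is Some v then
    if j is i.+1 then onth (map (vid G) (ports G v)) i else Some (degree G v)
  else None.

(* Adaptive deterministic probing: [Probe x j k] probes cell (x, j) and
   continues with [k] applied to the content of that cell. *)
Inductive probe_tree (A : Type) : Type :=
| Answer of A
| Probe (x j : nat) of (option nat -> probe_tree A).

Fixpoint run (A : Type) (mem : nat -> nat -> option nat) (t : probe_tree A) : A :=
  match t with
  | Answer a => a
  | Probe x j k => run mem (k (mem x j))
  end.

Fixpoint cost (A : Type) (mem : nat -> nat -> option nat) (t : probe_tree A)
    : nat :=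
  match t with
  | Answer _ => 0
  | Probe x j k => (cost mem (k (mem x j))).+1
  end.

(* An algorithm is given the number of vertices and the ID of the queried
   vertex; it keeps no state between queries. *)
Definition lca (A : Type) : Type := nat -> nat -> probe_tree A.

Definition lca_answer (A : Type) (L : lca A) (T : finType) (G : input_graph T)
    (v : T) : A :=
  run (cell G) (L #|T| (vid G v)).

Definition lca_probes (A : Type) (L : lca A) (T : finType) (G : input_graph T)
    (v : T) : nat :=
  cost (cell G) (L #|T| (vid G v)).

Definition weak_2coloring (T : finType) (G : input_graph T) (col : T -> bool)
    : Prop :=
  forall v, (exists u, adj G v u) -> exists2 u, adj G v u & col u != col v.

(* All answers agree with one and the same weak 2-coloring. *)
Definition lca_weak_2colors (L : lca bool) (T : finType) (G : input_graph T)
    : Prop :=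
  exists col : T -> bool,
    weak_2coloring G col /\ forall v, lca_answer L G v = col v.

(* The IDs lie in a range of polynomial size; c = 1 covers both
   {0, ..., n - 1} and {1, ..., n}. *)
Definition ids_bounded (c : nat) (T : finType) (G : input_graph T) : Prop :=
  forall v, vid G v <= #|T| ^ c.

(* Main.v *)
Require Import Defs.
From mathcomp Require Import all_boot.
From mathcomp Require Import zify.

(** Let [f v] be the neighbor at the first port of [v]; following [f] costs one
    probe per step.  Cole-Vishkin along [f] turns the IDs, in [logstar n + 1]
    rounds, into a coloring with a constant number of colors in which [v] and
    [f v] always differ.  Every constant-length stretch of the [f]-path of [v]
    then contains a local maximum of the colors, and no two consecutive vertices
    are local maxima, so the parity [P v] of the distance to the next local
    maximum never takes the same value on [v], [f v] and [f (f v)].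
    A vertex [v] with an [f]-preimage gets the color [P v], and a vertex without
    one gets [~~ P (f v)].  Probing all ports of [v] and the first port of every
    neighbor decides which case applies, for [2 * degree v] probes. *)

Set Implicit Arguments.
Unset Strict Implicit.
Unset Printing Implicit Defensive.

(** * Least witness of a predicate below a bound *)

Lemma find_iota0 (p : pred nat) (N i : nat) : i < N -> p i ->
  [/\ p (find p (iota 0 N)), find p (iota 0 N) <= i
    & forall j, j < find p (iota 0 N) -> ~~ p j].
Proof.
move=> iN pi.
have hp : has p (iota 0 N) by apply/hasP; exists i; rewrite ?mem_iota.
have ltf : find p (iota 0 N) < N by rewrite -[X in _ < X](size_iota 0) -has_find.
have notp j : j < find p (iota 0 N) -> ~~ p j.
  move=> ltj; move: (before_find 0 ltj).
  by rewrite nth_iota ?add0n ?(ltn_trans ltj) // => ->.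
split=> //; first by have := nth_find 0 hp; rewrite nth_iota.
by rewrite leqNgt; apply/negP => /notp; rewrite pi.
Qed.

Lemma find_iota0_eq (p : pred nat) (N i : nat) : i < N -> p i ->
  (forall j, j < i -> ~~ p j) -> find p (iota 0 N) = i.
Proof.
move=> iN pi np; have [pf lef _] := find_iota0 iN pi.
apply/eqP; rewrite eqn_leq lef leqNgt; apply/negP => /np; by rewrite pf.
Qed.

(** * Cole-Vishkin color reduction *)

Definition bit (x i : nat) : bool := odd (x %/ 2 ^ i).

Lemma bit_neq (b x y : nat) : x < 2 ^ b -> y < 2 ^ b -> x != y ->
  exists2 i, i < b & bit x i != bit y i.
Proof.
elim: b x y => [|b IH] x y; first by case: x y => [|//] [|//].
rewrite expnS => xb yb neq.
have [eqo|neqo] := eqVneq (odd x) (odd y); last first.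
  by exists 0 => //; rewrite /bit !divn1.
have [|||i ib neqi] := IH (x %/ 2) (y %/ 2); first 3 last.
- by exists i.+1; rewrite // /bit expnS !divnMA.
- by lia.
- by lia.
by apply: contraNneq neq; rewrite !divn2 => eqh;
  rewrite -(odd_double_half x) -(odd_double_half y) eqo eqh.
Qed.

(** The search range suffices for distinct [x] and [y], since both lie below [2 ^ (x + y)]. *)
Definition diff_bit (x y : nat) : nat :=
  find (fun i => bit x i != bit y i) (iota 0 (x + y)).

(** The Cole-Vishkin step: the lowest position where [x] differs from [y], paired with the bit of
    [x] there, coded as one number. *)
Definition cv (x y : nat) : nat := (diff_bit x y).*2 + bit x (diff_bit x y).

Lemma diff_bitP (x y b : nat) : x < 2 ^ b -> y < 2 ^ b -> x != y ->
  diff_bit x y < b /\ bit x (diff_bit x y) != bit y (diff_bit x y).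
Proof.
move=> xb yb neq.
have [||i i_xy ne_i] := @bit_neq (x + y) x y _ _ neq.
- by apply: leq_trans (ltn_expl x (isT : 1 < 2)) _; rewrite leq_exp2l ?leq_addr.
- by apply: leq_trans (ltn_expl y (isT : 1 < 2)) _; rewrite leq_exp2l ?leq_addl.
have [p_d _ min_d] := find_iota0 (p := fun i => bit x i != bit y i) i_xy ne_i.
split=> //; have [j jb nej] := bit_neq xb yb neq.
apply: leq_ltn_trans jb; rewrite leqNgt; apply/negP => /min_d.
by rewrite nej.
Qed.

Lemma cv_bound (a x y : nat) : x < a -> y < a -> x != y -> cv x y < 2 * up_log 2 a.
Proof.
move=> xa ya neq; have le_a := up_logP a (isT : 1 < 2).
have [lt_d _] := diff_bitP (leq_trans xa le_a) (leq_trans ya le_a) neq.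
by rewrite /cv; lia.
Qed.

(** Equal codes would share both position and bit, but [x] and [y] have different bits at position
    [diff_bit x y]. *)
Lemma cv_neq (x y z : nat) : x != y -> cv x y != cv y z.
Proof.
move=> xy; have [||_ ne_b] := @diff_bitP x y (x + y) _ _ xy.
- by apply: leq_trans (ltn_expl x (isT : 1 < 2)) _; rewrite leq_exp2l ?leq_addr.
- by apply: leq_trans (ltn_expl y (isT : 1 < 2)) _; rewrite leq_exp2l ?leq_addl.
apply/negP => /eqP; rewrite /cv => eq_cv.
have eq_d : diff_bit x y = diff_bit y z by lia.
by move: eq_cv; rewrite -eq_d => /addnI; move: ne_b; do 2 case: (bit _ _).
Qed.

Fixpoint cv_iter (k : nat) (X : nat -> nat) (i : nat) : nat :=
  if k is k'.+1 then cv (cv_iter k' X i) (cv_iter k' X i.+1) else X i.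

Lemma cv_iter_shift (k : nat) (X : nat -> nat) (i : nat) :
  cv_iter k (fun j => X j.+1) i = cv_iter k X i.+1.
Proof. by elim: k i => //= k IH i; rewrite !IH. Qed.

Lemma eq_cv_iter (k N i : nat) (X Y : nat -> nat) :
  (forall j, j <= N -> X j = Y j) -> i + k <= N -> cv_iter k X i = cv_iter k Y i.
Proof.
move=> eqXY; elim: k i => [|k IH] i ikN /=; first by apply: eqXY; lia.
by rewrite !IH //; lia.
Qed.

(** A number of colors that suffices after [k] rounds started with [a] colors. *)
Definition palette (k a : nat) : nat := iter k (fun b => 2 * up_log 2 b) a.

Lemma cv_iterP (k a : nat) (X : nat -> nat) :
  (forall i, X i < a) -> (forall i, X i != X i.+1) ->
  forall i, cv_iter k X i < palette k a /\ cv_iter k X i != cv_iter k X i.+1.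
Proof.
move=> Xa Xneq; elim: k => [|k IH] i //=.
have [lt0 ne0] := IH i; have [lt1 ne1] := IH i.+1.
by split; [apply: cv_bound | apply: cv_neq].
Qed.

(** Explains the exponent [c + 3]: at [c = 0] both sides equal 8. *)
Lemma expn2_lower (c : nat) : 2 * (c + 3).+1 <= 2 ^ (c + 3).
Proof. by elim: c => // c IH; rewrite addSn expnS; lia. Qed.

Lemma leq_S_expn2_up_log (x : nat) : x.+1 <= 2 ^ (up_log 2 x).+1.
Proof.
have := up_logP x (isT : 1 < 2); have : 0 < 2 ^ up_log 2 x by rewrite expn_gt0.
by rewrite expnS; lia.
Qed.

(* The factor 2 lost in every round stays inside the constant [2 ^ (c + 3)]. *)
Lemma palette_bound (c n k : nat) :
  palette k.+1 (n ^ c).+1 <= 2 ^ (c + 3) * (iter k.+1 (up_log 2) n).+1.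
Proof.
have low := expn2_lower c.
elim: k => [|k IH].
  rewrite /palette /=.
  suff le : up_log 2 (n ^ c).+1 <= (c * up_log 2 n).+1.
    have : c * up_log 2 n <= c.+1 * up_log 2 n by rewrite leq_mul.
    have : 2 * (c + 3).+1 * (up_log 2 n).+1 <= 2 ^ (c + 3) * (up_log 2 n).+1.
      by rewrite leq_mul.
    by nia.
  apply: up_log_min => //; rewrite expnS mulnC [c * _]mulnC expnM.
  have : n ^ c <= (2 ^ up_log 2 n) ^ c.
    by case: (c) => // c'; rewrite leq_exp2r // up_logP.
  by have : 0 < (2 ^ up_log 2 n) ^ c; [rewrite !expn_gt0 | lia].
rewrite /palette iterS -/(palette _ _) [iter k.+2 _ _]iterS.
set x := iter k.+1 (up_log 2) n in IH *.
(* The logarithm turns the constant factor in [IH] into the summand [c + 3]. *)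
have le : up_log 2 (palette k.+1 (n ^ c).+1) <= c + 3 + (up_log 2 x).+1.
  apply: up_log_min => //; rewrite expnD; apply: leq_trans IH _.
  by rewrite leq_mul // leq_S_expn2_up_log.
have : 2 * (c + 3).+1 * (up_log 2 x).+1 <= 2 ^ (c + 3) * (up_log 2 x).+1.
  by rewrite leq_mul.
by nia.
Qed.

Lemma palette_logstar (c n : nat) :
  palette (logstar n).+1 (n ^ c).+1 <= 2 ^ (c + 3).
Proof.
have [le1 _] := logstarP n; apply: leq_trans (palette_bound c n _) _.
(* After [logstar n] logarithms at most 1 is left; the extra round brings it to 0 and the bound to
   [2 ^ (c + 3)]. *)
rewrite iterS (_ : up_log 2 _ = 0) ?muln1 //.
by case: (iter _ _ _) le1 => [|[|]].
Qed.

(** * Parity of the distance to the next local maximum *)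

(** The peak sits at [i.+1], so that only indices ahead on the path are read. *)
Definition local_max (Y : nat -> nat) (i : nat) : bool :=
  (Y i < Y i.+1) && (Y i.+2 < Y i.+1).

(** Colors below [K] cannot descend forever, so an ascent starts at some [i <= K]; with no peak in
    the next [K] steps the ascent would go on and exceed [K]. *)
Lemma local_max_exists (K : nat) (Y : nat -> nat) :
  (forall i, Y i < K) -> (forall i, Y i != Y i.+1) ->
  exists2 i, i <= K.*2 & local_max Y i.
Proof.
move=> YK Yneq.
have [i iK asc] : exists2 i, i <= K & Y i < Y i.+1.
  have [/hasP[i]|/hasPn desc] := boolP (has (fun i => Y i < Y i.+1) (iota 0 K.+1)).
    by rewrite mem_iota => iK asc; exists i; lia.
  have dec i : i <= K -> Y i + i <= Y 0.
    elim: i => [|i IH] iK; first by lia.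
    have := desc i; rewrite mem_iota => /(_ _); move: (Yneq i) => ? d.
    have := IH (ltnW iK); have := d ltac:(lia); lia.
  by have := dec K (leqnn K); have := YK 0; lia.
have [/hasP[j]|/hasPn nomax] := boolP (has (fun j => local_max Y (i + j)) (iota 0 K.+1)).
  by rewrite mem_iota => jK lm; exists (i + j) => //; lia.
have inc j : j <= K -> j <= Y (i + j) /\ Y (i + j) < Y (i + j).+1.
  elim: j => [|j IH] jK; first by rewrite addn0.
  have [leY ltY] := IH (ltnW jK).
  have := nomax j; rewrite mem_iota /local_max ltY /= => /(_ ltac:(lia)).
  by rewrite addnS; have := Yneq (i + j).+1; lia.
by have [] := inc K (leqnn K); have := YK (i + K); lia.
Qed.

Definition parity (K : nat) (Y : nat -> nat) : bool :=
  odd (find (local_max Y) (iota 0 K.*2.+1)).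

Lemma eq_parity (K : nat) (Y Z : nat -> nat) :
  (forall i, i <= K.*2.+2 -> Y i = Z i) -> parity K Y = parity K Z.
Proof.
move=> eqYZ; congr odd; apply: eq_in_find => i; rewrite mem_iota => iK.
by rewrite /local_max !eqYZ //; lia.
Qed.

(** If the nearest peak is not at 0, dropping the first color shortens the distance to it by exactly
    one. *)
Lemma parity_shift (K : nat) (Y : nat -> nat) :
  (forall i, Y i < K) -> (forall i, Y i != Y i.+1) ->
  ~~ local_max Y 0 -> parity K (fun i => Y i.+1) = ~~ parity K Y.
Proof.
move=> YK Yneq notmax0; have [i iK maxi] := local_max_exists YK Yneq.
have [] := find_iota0 (p := local_max Y) (iK : i < K.*2.+1) maxi.
rewrite /parity; case: (find _ _) => [|m]; first by rewrite (negPf notmax0).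
move=> maxm mi minm; rewrite (@find_iota0_eq _ _ m) //=; first 1 last.
- by apply: leq_trans mi _; apply: leqW.
- by move=> j jm; apply: (minm j.+1).
by rewrite negbK.
Qed.

(** Equal parities force a peak at 0; then there is none at 1, and the next shift flips the
    parity. *)
Lemma parity_not_constant (K : nat) (Y : nat -> nat) :
  (forall i, Y i < K) -> (forall i, Y i != Y i.+1) ->
  parity K Y = parity K (fun i => Y i.+1) ->
  parity K (fun i => Y i.+1) != parity K (fun i => Y i.+2).
Proof.
move=> YK Yneq eqP; have [max0|notmax0] := boolP (local_max Y 0); last first.
  by move: eqP; rewrite parity_shift //; case: (parity _ _).
rewrite (@parity_shift K (fun i => Y i.+1)) //; first by case: (parity _ _).
by move: max0; rewrite /local_max; lia.
Qed.

(** * The algorithm *)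

Fixpoint bind (A B : Type) (t : probe_tree A) (k : A -> probe_tree B) : probe_tree B :=
  match t with
  | Answer a => k a
  | Probe x j g => Probe x j (fun r => bind (g r) k)
  end.

Lemma run_bind (A B : Type) mem (t : probe_tree A) (k : A -> probe_tree B) :
  run mem (bind t k) = run mem (k (run mem t)).
Proof. by elim: t => //= x j g IH; rewrite IH. Qed.

Lemma cost_bind (A B : Type) mem (t : probe_tree A) (k : A -> probe_tree B) :
  cost mem (bind t k) = cost mem t + cost mem (k (run mem t)).
Proof. by elim: t => //= x j g IH; rewrite IH. Qed.

Fixpoint walk (m x : nat) : probe_tree (seq nat) :=
  if m is m'.+1 then
    Probe x 1 (fun r => bind (walk m' (odflt 0 r)) (fun s => Answer (x :: s)))
  else Answer [:: x].

(** Probing goes on after a success, so the cost is always two probes per port. *)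
Fixpoint probe_child (d x : nat) : probe_tree bool :=
  if d is d'.+1 then
    Probe x d (fun r => Probe (odflt 0 r) 1 (fun q =>
      bind (probe_child d' x) (fun b => Answer ((q == Some x) || b))))
  else Answer false.

(* [parity K] reads the colors up to index [K.*2.+2], each color reads [s] more
   IDs, and the parity of the parent starts one step further. *)
Definition probe_color (K s d x : nat) : probe_tree bool :=
  bind (probe_child d x) (fun b =>
  bind (walk (K.*2 + 3 + s) x) (fun l => Answer
    (if b then parity K (cv_iter s (nth 0 l))
     else ~~ parity K (cv_iter s (fun i => nth 0 l i.+1))))).

Definition weak_2color_lca (K : nat) : lca bool := fun n x =>
  Probe x 0 (fun r =>
    if odflt 0 r is d.+1 then probe_color K (logstar n).+1 d.+1 x
    else Answer false).

(** * The first-port map of the input graph *)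

Section Correctness.
Variables (T : finType) (G : input_graph T).

Definition parent (v : T) : T := head v (ports G v).

Definition isolated (v : T) : bool := ports G v == [::].

Definition has_child (v : T) : bool := has (fun u => parent u == v) (ports G v).

Lemma adj_isolated (v u : T) : adj G v u -> ~~ isolated v.
Proof. by rewrite -mem_ports /isolated; case: (ports G v). Qed.

Lemma adj_parent (v : T) : ~~ isolated v -> adj G v (parent v).
Proof.
by rewrite -mem_ports /isolated /parent; case: (ports G v) => //= u l _; rewrite mem_head.
Qed.

Lemma parent_isolated (v : T) : ~~ isolated v -> ~~ isolated (parent v).
Proof. by move=> /adj_parent; rewrite adj_sym => /adj_isolated. Qed.

Lemma iter_parent_isolated (v : T) (i : nat) :
  ~~ isolated v -> ~~ isolated (iter i parent v).
Proof. by move=> v_iso; elim: i => //= i; apply: parent_isolated. Qed.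

Lemma parent_has_child (v : T) : ~~ isolated v -> has_child (parent v).
Proof.
move=> v_iso; apply/hasP; exists v => //.
by rewrite mem_ports adj_sym adj_parent.
Qed.

Lemma degree_ports (v : T) : degree G v = size (ports G v).
Proof.
rewrite /degree -(card_uniqP (ports_uniq G v)); apply: eq_card => u.
by rewrite inE mem_ports.
Qed.

(** * Results and costs of the probe programs *)

Lemma cell_vid (v : T) (j : nat) : cell G (vid G v) j =
  if j is i.+1 then onth (map (vid G) (ports G v)) i else Some (degree G v).
Proof.
rewrite /cell; case: pickP => [u /eqP/(@vid_inj _ G) -> //|/(_ v)].
by rewrite eqxx.
Qed.

Lemma cell_parent (v : T) : ~~ isolated v -> cell G (vid G v) 1 = Some (vid G (parent v)).
Proof. by rewrite cell_vid /isolated /parent; case: (ports G v). Qed.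

Lemma run_walk (m : nat) (v : T) : ~~ isolated v ->
  run (cell G) (walk m (vid G v)) = map (vid G) (traject parent v m.+1).
Proof.
elim: m v => [|m IH] v v_iso //=.
by rewrite run_bind cell_parent //= IH ?parent_isolated.
Qed.

Lemma cost_walk (m x : nat) : cost (cell G) (walk m x) = m.
Proof. by elim: m x => //= m IH x; rewrite cost_bind IH addn0. Qed.

Lemma run_probe_child (d : nat) (v : T) : d <= size (ports G v) ->
  run (cell G) (probe_child d (vid G v)) =
  has (fun u => parent u == v) (take d (ports G v)).
Proof.
elim: d => [|d IH] d_size /=; first by rewrite take0.
pose u := nth v (ports G v) d.
have -> : cell G (vid G v) d.+1 = Some (vid G u).
  by rewrite cell_vid onthE -map_comp (nth_map v).
have u_iso : ~~ isolated u.
  by apply: (@adj_isolated u v); rewrite adj_sym -mem_ports mem_nth.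
rewrite /= cell_parent // run_bind IH 1?ltnW //= (take_nth v) // has_rcons -/u.
by rewrite (inj_eq (@Some_inj _)) (inj_eq (@vid_inj _ G)).
Qed.

Lemma cost_probe_child (d x : nat) : cost (cell G) (probe_child d x) = 2 * d.
Proof. by elim: d => //= d IH; rewrite cost_bind IH /=; lia. Qed.

(** * The coloring and its validity *)

Section Coloring.
Variables (c : nat) (ids : ids_bounded c G).

Let K := 2 ^ (c + 3).
Let s := (logstar #|T|).+1.

Definition path_color (v : T) : nat -> nat :=
  cv_iter s (fun i => vid G (iter i parent v)).

Definition path_parity (v : T) : bool := parity K (path_color v).

Definition weak_color (v : T) : bool :=
  if isolated v then false
  else if has_child v then path_parity v else ~~ path_parity (parent v).

(** Makes separate queries consistent: the walks from [v] and from its parent see the same colors,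
    shifted by one. *)
Lemma path_color_parent (v : T) (i : nat) :
  path_color (parent v) i = path_color v i.+1.
Proof.
rewrite /path_color -cv_iter_shift; apply: (@eq_cv_iter s (i + s)) => // j _.
by rewrite -iterSr.
Qed.

Lemma path_colorP (v : T) : ~~ isolated v ->
  forall i, path_color v i < K /\ path_color v i != path_color v i.+1.
Proof.
move=> v_iso i.
have [|j|lt ne] := @cv_iterP s (#|T| ^ c).+1 (fun i => vid G (iter i parent v)) _ _ i.
- by move=> j; rewrite ltnS ids.
- rewrite (inj_eq (@vid_inj _ G)) iterS; apply/eqP => eq_p.
  have := adj_parent (iter_parent_isolated j v_iso).
  by rewrite -eq_p adj_irr.
by split=> //; apply: leq_trans lt (palette_logstar _ _).
Qed.

Lemma path_parity_not_constant (v : T) : ~~ isolated v ->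
  path_parity v = path_parity (parent v) ->
  path_parity (parent v) != path_parity (parent (parent v)).
Proof.
move=> v_iso.
have E1 : path_parity (parent v) = parity K (fun i => path_color v i.+1).
  by apply: eq_parity => i _; rewrite path_color_parent.
have E2 : path_parity (parent (parent v)) = parity K (fun i => path_color v i.+2).
  by apply: eq_parity => i _; rewrite !path_color_parent.
rewrite E1 E2; apply: parity_not_constant => i; by case: (path_colorP v_iso i).
Qed.

Lemma weak_color_has_child (v : T) :
  ~~ isolated v -> has_child v -> weak_color v = path_parity v.
Proof. by rewrite /weak_color => /negPf -> ->. Qed.

Lemma weak_colorP : weak_2coloring G weak_color.
Proof.
move=> v [w /adj_isolated v_iso].
have col_p := weak_color_has_child (parent_isolated v_iso) (parent_has_child v_iso).
have [/[dup] v_child /hasP[u u_v /eqP pu]|v_leaf] := boolP (has_child v); last first.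
  (* The parent has the child [v], so its color is its own parity, which [v] negates. *)
  exists (parent v); first exact: adj_parent.
  by rewrite col_p /weak_color (negPf v_iso) (negPf v_leaf); case: path_parity.
have col_v := weak_color_has_child v_iso v_child.
have [eq_p|neq_p] := eqVneq (path_parity (parent v)) (path_parity v); last first.
  by exists (parent v); [exact: adj_parent | rewrite col_p col_v].
have adj_vu : adj G v u by rewrite -mem_ports.
have u_iso : ~~ isolated u by apply: (@adj_isolated u v); rewrite adj_sym.
(* Now [v] and its parent agree, so the child [u] must differ: without a child it negates the parity
   of [v], and otherwise agreement would give three equal parities in a row. *)
exists u => //; have [u_child|u_leaf] := boolP (has_child u); last first.
  by rewrite col_v /weak_color (negPf u_iso) (negPf u_leaf) pu; case: path_parity.
rewrite (weak_color_has_child u_iso u_child) col_v.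
apply/eqP => eq_u; have := path_parity_not_constant u_iso.
by rewrite pu => /(_ eq_u); rewrite eq_p eqxx.
Qed.

(** * Answers and probe count of the algorithm *)

Lemma weak_2color_lca_answer (v : T) :
  lca_answer (weak_2color_lca K) G v = weak_color v.
Proof.
rewrite /lca_answer /weak_2color_lca /= cell_vid /= degree_ports.
rewrite /weak_color.
have [iso|v_iso] := boolP (isolated v); first by rewrite (eqP iso).
case Ed: (size _) => [|d]; first by move: v_iso; rewrite /isolated -size_eq0 Ed.
rewrite -/s -Ed /probe_color !run_bind run_probe_child // take_size.
rewrite -/(has_child v) run_walk //; set N := K.*2 + 3 + s; set l := map _ _.
(* Past [N] the list yields the default 0, so the agreement holds only up to [N], the last index
   that the parities read. *)
have nth_l i : i <= N -> nth 0 l i = vid G (iter i parent v).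
  by move=> iN; rewrite (nth_map v) ?size_traject ?nth_traject.
rewrite /run; case: ifP => _; last congr negb.
  apply: eq_parity => i iK.
  by apply: (@eq_cv_iter s N) => //; rewrite /N; lia.
apply: eq_parity => i iK.
rewrite path_color_parent (cv_iter_shift s (nth 0 l)).
by apply: (@eq_cv_iter s N) => //; rewrite /N; lia.
Qed.

(** The 5 consists of the degree probe, the 3 extra steps of the walk and the extra Cole-Vishkin
    round. *)
Lemma weak_2color_lca_probes (v : T) :
  lca_probes (weak_2color_lca K) G v <=
    logstar #|T| + 2 * degree G v + (K.*2 + 5).
Proof.
rewrite /lca_probes /weak_2color_lca /= cell_vid /=.
case: (degree G v) => [|d] /=; first by lia.
by rewrite !cost_bind cost_probe_child cost_walk /=; lia.
Qed.

End Coloring.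
End Correctness.

Theorem theorem3 (c : nat) :
  exists (L : lca bool) (C : nat),
    forall (T : finType) (G : input_graph T), ids_bounded c G ->
      lca_weak_2colors L G /\
      forall v : T, lca_probes L G v <= logstar #|T| + 2 * degree G v + C.
Proof.
exists (weak_2color_lca (2 ^ (c + 3))), ((2 ^ (c + 3)).*2 + 5) => T G ids.
split; last exact: weak_2color_lca_probes.
exists (weak_color G c); split; first exact: weak_colorP ids.
by move=> v; apply: weak_2color_lca_answer.
Qed.
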